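(* Suppose that $X$ and $X^*$ are uniformly convex real Banach spaces. Let $A$ be a maximal monotone operator from $X$ to $X^*$ with minimal-norm selection $A^\circ$, and let $x\in D(A)$. Suppose that there exist $r>0$ and $\rho>0$ such that $$\|A^\circ y\|\le\rho\quad\text{for all } y\in B(x;r)\cap D(A).$$ Then, for every $y\in B(x;r)\cap D(A)$, $$Ay\subset N(y;\overline{D(A)})+\rho\,\overline{\mathbb{B}^*}.$$ In particular, if $B(x;r)\subset D(A)$, then $Ay\subset\rho\,\overline{\mathbb{B}^*}$ for every $y\in B(x;r)$.
   Context: $X^*$ is the continuous dual of $X$, $\langle\cdot,\cdot\rangle$ the duality pairing, $B(x;r)$ the open ball in $X$ with center $x$ and radius $r$, and $\overline{\mathbb{B}^*}$ the closed unit ball of $X^*$. For a set-valued operator $A:X\rightrightarrows X^*$, $D(A)=\{x\in X: Ax\neq\emptyset\}$. $A$ is monotone if $\langle x^*-y^*,x-y\rangle\ge 0$ whenever $x^*\in Ax$, $y^*\in Ay$, and maximal monotone if in addition its graph is not properly contained in the graph of another monotone operator. In this setting, for $x\in D(A)$ the set $Ax$ is nonempty, closed and convex, so it has a unique element of minimal norm, denoted $A^\circ x$; the map $A^\circ:D(A)\to X^*$ is the minimal-norm selection of $A$. The closure $\overline{D(A)}$ (norm topology) is convex. For a nonempty closed convex $S\subset X$ and $y\in S$, the normal cone is $N(y;S)=\{x^*\in X^*:\sup_{z\in S}\langle x^*,z-y\rangle\le0\}$. *)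

(* Defs.v *)
From HB Require Import structures.
From mathcomp Require Import all_boot all_order all_algebra.
From mathcomp Require Import all_classical all_reals all_analysis.

Set Implicit Arguments.
Unset Strict Implicit.
Unset Printing Implicit Defensive.

Import Order.TTheory GRing.Theory Num.Theory.
Import numFieldNormedType.Exports.

Local Open Scope classical_set_scope.
Local Open Scope ring_scope.

Section dual_space.
Context {R : realType} {X : normedModType R}.

Definition dual_pred : {pred X -> R^o} :=
  [pred f : X -> R^o | `[< linear f /\ continuous f >]].

Lemma dual_pred_submod_closed : submod_closed dual_pred.
Proof.
split.
  apply/asboolP; split=> [a u v|x]; last exact: cvg_cst.
  by rewrite [RHS](_ : _ = a *: (0 : R^o) + 0)// scaler0 addr0.
move=> a f g /asboolP[lf cf] /asboolP[lg cg]; apply/asboolP; split.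
  move=> b u v; rewrite !fctE /= lf lg !scalerDr !scalerA (mulrC a b) -!addrA.
  by congr (_ + _); rewrite addrCA.
by move=> x; apply: cvgD; [apply: cvgZr; exact: cf|exact: cg].
Qed.

HB.instance Definition _ :=
  GRing.isSubmodClosed.Build R (X -> R^o) dual_pred dual_pred_submod_closed.

End dual_space.
Arguments dual_pred {R} X.

Record dual {R : realType} (X : normedModType R) := Dual {
  dual_fun :> X -> R^o;
  dual_funP : dual_fun \in dual_pred X }.

Section dual_normed.
Context {R : realType} {X : normedModType R}.

HB.instance Definition _ := [isSub for @dual_fun R X].
HB.instance Definition _ := [Choice of dual X by <:].
HB.instance Definition _ := [SubChoice_isSubLmodule of dual X by <:].

Lemma dual_linear (f : dual X) : linear f.
Proof. by have /asboolP[] := dual_funP f. Qed.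

HB.instance Definition _ (f : dual X) :=
  GRing.isLinear.Build R X R^o *:%R f (dual_linear f).

Lemma dual_continuous (f : dual X) : continuous f.
Proof. by have /asboolP[] := dual_funP f. Qed.

Definition dual_norm (f : dual X) : R :=
  sup [set `|f x| | x in [set x : X | `|x| <= 1]].

Lemma dual_norm_has_sup (f : dual X) :
  has_sup [set `|f x| | x in [set x : X | `|x| <= 1]].
Proof.
split; first by exists `|f 0|, 0 => //=; rewrite normr0.
have /linear_bounded_continuous/bounded_funP/(_ 1)[M fM] := @dual_continuous f.
by exists M => _ [x /= x1 <-]; exact: fM.
Qed.

Lemma dual_norm_ub (f : dual X) (x : X) : `|x| <= 1 -> `|f x| <= dual_norm f.
Proof.
by move=> x1; apply: ub_le_sup; [case: (dual_norm_has_sup f)|exists x].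
Qed.

Lemma dual_norm_le (f : dual X) (M : R) :
  (forall x : X, `|x| <= 1 -> `|f x| <= M) -> dual_norm f <= M.
Proof.
move=> fM; apply: ge_sup; first by case: (dual_norm_has_sup f).
by move=> _ [x /= x1 <-]; exact: fM.
Qed.

Lemma dual_norm_ge0 (f : dual X) : 0 <= dual_norm f.
Proof. by apply: le_trans (dual_norm_ub f (x := 0) _); rewrite ?normr0. Qed.

Lemma dual_normP (f : dual X) (x : X) : `|f x| <= dual_norm f * `|x|.
Proof.
have [->|x0] := eqVneq x 0; first by rewrite linear0 !normr0 mulr0.
have nx : 0 < `|x| by rewrite normr_gt0.
rewrite -ler_pdivrMr// mulrC -[X in X * _]ger0_norm ?invr_ge0// -normrZ -linearZ.
apply: dual_norm_ub; rewrite normrZ ger0_norm ?invr_ge0//.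
by rewrite mulVf// normr_eq0.
Qed.

Lemma dual_normD (f g : dual X) : dual_norm (f + g) <= dual_norm f + dual_norm g.
Proof.
apply: dual_norm_le => x x1.
by rewrite (le_trans (ler_normD _ _))// lerD// dual_norm_ub.
Qed.

Lemma dual_normZ (a : R) (f : dual X) : dual_norm (a *: f) = `|a| * dual_norm f.
Proof.
have le b g : dual_norm (b *: g) <= `|b| * dual_norm g.
  by apply: dual_norm_le => x x1; rewrite normrZ ler_wpM2l// dual_norm_ub.
apply/eqP; rewrite eq_le le/=.
have [->|a0] := eqVneq a 0; first by rewrite normr0 mul0r dual_norm_ge0.
rewrite -ler_pdivlMl ?normr_gt0// -normfV.
by rewrite -[leLHS](_ : dual_norm (a^-1 *: (a *: f)) = _) ?le// scalerA mulVf// scale1r.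
Qed.

Lemma dual_norm0_eq0 (f : dual X) : dual_norm f = 0 -> f = 0.
Proof.
move=> f0; apply/val_inj/funext => x /=.
by apply/eqP; rewrite -normr_le0; have := dual_normP f x; rewrite f0 mul0r.
Qed.

HB.instance Definition _ :=
  Lmodule_isNormed.Build R (dual X) dual_normD dual_normZ dual_norm0_eq0.

End dual_normed.

Definition pairing {R : realType} {X : normedModType R} (f : dual X) (x : X) : R :=
  f x.

Definition uniformly_convex {R : realType} (V : normedModType R) : Prop :=
  forall eps : R, 0 < eps -> eps <= 2 ->
  exists2 delta : R, 0 < delta &
    forall x y : V, `|x| = 1 -> `|y| = 1 -> eps <= `|x - y| ->
      `|2^-1 *: (x + y)| <= 1 - delta.

Section operators.
Context {R : realType} {X : normedModType R}.
Implicit Types (A B : X -> set (dual X)) (S : set X).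

Definition op_domain A : set X := [set x | A x !=set0].

Definition op_graph A : set (X * dual X) := [set p | A p.1 p.2].

Definition monotone_op A : Prop :=
  forall (x y : X) (x' y' : dual X), A x x' -> A y y' ->
    0 <= pairing (x' - y') (x - y).

Definition maximal_monotone A : Prop :=
  monotone_op A /\
  forall B, monotone_op B -> ~ (op_graph A `<` op_graph B).

Definition min_norm_elements (C : set (dual X)) : set (dual X) :=
  [set f | C f /\ forall g, C g -> `|f| <= `|g|].

(* The value is the junk 0 only where the set of minimal-norm elements is empty,
   in particular outside the domain of A; for a maximal monotone A and uniformly
   convex X and dual X, that set is a singleton at every point of the domain. *)
Definition min_norm_selection A (x : X) : dual X :=
  xget 0 (min_norm_elements (A x)).

Definition normal_cone (y : X) S : set (dual X) :=
  [set f | (ereal_sup [set (pairing f (z - y))%:E | z in S] <= 0)%E].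

Definition dual_closed_unit_ball : set (dual X) := [set f | `|f| <= 1].

End operators.
Arguments dual_closed_unit_ball {R} X.

(* Main.v *)
Require Import Defs.
From HB Require Import structures.
From mathcomp Require Import all_boot all_order all_algebra.
From mathcomp Require Import all_classical all_reals all_analysis.
From mathcomp Require Import ring lra.
Import Order.TTheory GRing.Theory Num.Theory.
Import numFieldNormedType.Exports.
Local Open Scope classical_set_scope.
Local Open Scope ring_scope.

(** Monotonicity against the bounded selection at points [w] of [D(A)] near
    [y + s (z - y)] gives [y' (z - y) <= rho |z - y|] for [y'] in [A y] and [z]
    in the closure of [D(A)]; a Hahn-Banach sandwich on the cone generated by
    [closure D(A) - y] then yields [b] with [|b| <= rho] and [y' <= b] on that
    cone, so that [y' - b] is normal at [y].

    Such points [w] exist because [closure D(A)] is convex, which follows from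
    the solvability of [0 \in J (w - u) + lam A w] as [lam] tends to [0]. That
    equation is solved by minimising the Fitzpatrick function of [A] plus
    [(|x|^2 + |x'|^2) / 2] on [X * X']: uniform convexity makes minimising
    sequences Cauchy, and, by duality, makes both squared norms differentiable,
    so the minimiser satisfies a first-order condition from which maximality
    of [A] produces a solution. *)

(** * Sublinear functionals and the Hahn-Banach theorem *)

Section hahn_banach.
Context {R : realType} {V : lmodType R}.
Implicit Types (p q : V -> R) (K : set (V * R)).

Definition sublinear q : Prop :=
  (forall x y, q (x + y) <= q x + q y) /\
  (forall (a : R) x, 0 <= a -> q (a *: x) = a * q x).

(** A pair [(v, t)] in [K] encodes the constraint [t <= f v] on the linear functional [f] that is
    sought. *)
Definition convex_cone K : Prop :=
  [/\ K (0, 0),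
      forall k l, K k -> K l -> K (k.1 + l.1, k.2 + l.2) &
      forall (a : R) k, 0 <= a -> K k -> K (a *: k.1, a * k.2)].

(** The inequality for [a^-1] at [a *: x] is the reverse of the inequality for [a] at [x]. *)
Lemma sublinearW q : q 0 = 0 -> (forall x y, q (x + y) <= q x + q y) ->
  (forall (a : R) x, 0 < a -> q (a *: x) <= a * q x) -> sublinear q.
Proof.
move=> q0 qD qZ; split=> // a x; rewrite le_eqVlt => /orP[/eqP <-|a0].
  by rewrite scale0r mul0r.
apply/eqP; rewrite eq_le qZ//= -ler_pdivlMl//.
by have := qZ a^-1 (a *: x); rewrite invr_gt0 scalerA mulVf ?gt_eqF// scale1r; apply.
Qed.

Lemma sublinear0 q : sublinear q -> q 0 = 0.
Proof. by move=> [_ qZ]; have := qZ 0 0 (lexx _); rewrite scale0r mul0r. Qed.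

Lemma sublinear_geN q x : sublinear q -> - q (- x) <= q x.
Proof.
move=> sq; have [qD _] := sq; have := qD x (- x).
by rewrite subrr sublinear0//; lra.
Qed.

(** For sublinear [q], a linear [f] below this function lies below [q] (take [k = (0, 0)] in [K])
    and satisfies [k.2 <= f k.1] on [K] (evaluate at [- k.1]). *)
Definition cone_inf q K x : R := inf [set q (x + k.1) - k.2 | k in K].

Section cone_inf.
Variables (q : V -> R) (K : set (V * R)).
Hypotheses (sq : sublinear q) (cK : convex_cone K).
Hypothesis Kq : forall k, K k -> k.2 <= q k.1.

Let lbq x : lbound [set q (x + k.1) - k.2 | k in K] (- q (- x)).
Proof.
move=> _ [k Kk <-]; have [qD _] := sq; have := qD (x + k.1) (- x).
by rewrite addrAC subrr add0r; have := Kq _ Kk; lra.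
Qed.

Let neq0 x : [set q (x + k.1) - k.2 | k in K] !=set0.
Proof. by case: cK => K0 _ _; exists (q (x + 0) - 0), (0, 0). Qed.

Lemma cone_inf_le x k : K k -> cone_inf q K x <= q (x + k.1) - k.2.
Proof. by move=> Kk; apply: ge_inf; [exists (- q (- x)); exact: lbq|exists k]. Qed.

Lemma le_cone_inf x m : (forall k, K k -> m <= q (x + k.1) - k.2) ->
  m <= cone_inf q K x.
Proof. by move=> mP; apply: lb_le_inf => // _ [k Kk <-]; exact: mP. Qed.

Lemma cone_inf_sublinear : sublinear (cone_inf q K).
Proof.
have [K0 KD KZ] := cK; have [qD qZ] := sq; apply: sublinearW.
- apply/eqP; rewrite eq_le; apply/andP; split.
    by have := cone_inf_le 0 _ K0; rewrite /= addr0 subr0 (sublinear0 _ sq).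
  by apply: le_cone_inf => k Kk; rewrite add0r subr_ge0 Kq.
- move=> x y; rewrite -lerBlDr; apply: le_cone_inf => k Kk.
  rewrite lerBlDr -lerBlDl; apply: le_cone_inf => l Kl.
  have := cone_inf_le (x + y) _ (KD _ _ Kk Kl); have := qD (x + k.1) (y + l.1).
  by rewrite /= addrACA; lra.
- move=> a x a0; rewrite -ler_pdivrMl//; apply: le_cone_inf => k Kk.
  rewrite ler_pdivrMl// mulrBr -(qZ _ _ (ltW a0)) scalerDr.
  exact: (cone_inf_le _ _ (KZ _ _ (ltW a0) Kk)).
Qed.

End cone_inf.

(** Supplies the bounds of chains for Zorn's lemma. The pointwise infimum is finite because every
    member is comparable with a fixed [f], hence at least [- f (- x)] at [x]; it is subadditive
    because two members of a chain can both be replaced by the smaller one. *)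
Lemma sublinear_inf (F : set (V -> R)) : F !=set0 ->
  (forall q, F q -> sublinear q) ->
  total_on F (fun q q' => forall x, q x <= q' x) ->
  exists2 q0, sublinear q0 & forall q, F q -> forall x, q0 x <= q x.
Proof.
move=> [f Ff] sF totF; pose m x := inf [set q x | q in F].
have lbm x : lbound [set q x | q in F] (- f (- x)).
  move=> _ [q Fq <-]; case: (totF _ _ Fq Ff) => le.
    apply: le_trans (sublinear_geN _ x (sF _ Fq)); rewrite lerN2; exact: le.
  exact: le_trans (sublinear_geN _ x (sF _ Ff)) (le x).
have m_le q x : F q -> m x <= q x.
  by move=> Fq; apply: ge_inf; [exists (- f (- x))|exists q].
have le_m x c : (forall q, F q -> c <= q x) -> c <= m x.
  by move=> cP; apply: lb_le_inf; [exists (f x), f|move=> _ [q Fq <-]; exact: cP].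
exists m; last by move=> q Fq x; exact: m_le.
apply: sublinearW.
- apply/eqP; rewrite eq_le -{1}(sublinear0 _ (sF _ Ff)) m_le//=.
  by apply: (le_m) => q /sF/sublinear0 ->.
- move=> x y; rewrite -lerBlDr; apply: (le_m) => q Fq.
  rewrite lerBlDr -lerBlDl; apply: (le_m) => q' Fq'; rewrite lerBlDr.
  have [qD _] := sF _ Fq; have [qD' _] := sF _ Fq'.
  case: (totF _ _ Fq Fq') => le.
    by apply: le_trans (m_le _ _ Fq) _; have := qD x y; have := le y; lra.
  by apply: le_trans (m_le _ _ Fq') _; have := qD' x y; have := le x; lra.
- move=> a x a0; rewrite -ler_pdivrMl//; apply: (le_m) => q Fq.
  by have [_ qZ] := sF _ Fq; rewrite ler_pdivrMl// -(qZ _ _ (ltW a0)) m_le.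
Qed.

(* A minimal sublinear functional is linear, because [cone_inf] along the ray
   through [(x, q x)] would otherwise be strictly smaller at [- x]. *)
Lemma sublinear_minorant p : sublinear p ->
  exists2 f : V -> R, (forall a x y, f (a *: x + y) = a * f x + f y) &
    forall x, f x <= p x.
Proof.
move=> sp; pose T := {q : V -> R | sublinear q /\ forall x, q x <= p x}.
(* The order is reversed, so that a maximal element for [le] is a minimal sublinear functional. *)
pose le (s t : T) := `[< forall x, sval t x <= sval s x >].
have [||||[q [sq qp]] qmin] := @Zorn T le.
- by move=> t; apply/asboolP.
- by move=> r s t /asboolP rs /asboolP st; apply/asboolP => x; exact: le_trans (rs x).
- move=> [s Ps] [t Pt] /asboolP st /asboolP ts; apply: eq_exist.
  by apply/funext => x; apply/eqP; rewrite eq_le; apply/andP; split; [exact: ts|exact: st].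
- move=> F totF; have [F0|/set0P/negP/negPn/eqP F0] := pselect (F !=set0); last first.
    (* The empty chain is bounded by [p] itself. *)
    by exists (exist _ p (conj sp (fun=> lexx _))) => s; rewrite F0.
  have [|q Fq||q sq qle] := @sublinear_inf [set sval s | s in F].
  + by have [s Fs] := F0; exists (sval s), s.
  + move: Fq => [s _ <-]; exact: (svalP s).1.
  + move=> _ _ [s Fs <-] [t Ft <-].
    by case: (totF _ _ Fs Ft) => /asboolP; [right|left].
  have qp x : q x <= p x.
    have [s Fs] := F0; apply: le_trans ((svalP s).2 x).
    by apply: qle; exists s.
  exists (exist _ q (conj sq qp)) => s Fs; apply/asboolP => x /=.
  by apply: qle; exists s.
have [qD qZ] := sq; have qN x : q (- x) = - q x.
  apply/eqP; rewrite eq_le; apply/andP; split; last first.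
    by have := sublinear_geN _ (- x) sq; rewrite opprK.
  pose K : set (V * R) := [set k | exists2 a, 0 <= a & k = (a *: x, a * q x)].
  have cK : convex_cone K.
    split.
    - by exists 0; rewrite ?scale0r ?mul0r.
    - move=> _ _ [a a0 ->] [b b0 ->]; exists (a + b); first by rewrite addr_ge0.
      by rewrite scalerDl mulrDl.
    - move=> a _ a0 [b b0 ->]; exists (a * b); first by rewrite mulr_ge0.
      by rewrite /= scalerA mulrA.
  have Kq k : K k -> k.2 <= q k.1 by move=> [a a0 ->] /=; rewrite qZ.
  have sK := cone_inf_sublinear _ _ sq cK Kq.
  have Kleq y : cone_inf q K y <= q y.
    have [K0 _ _] := cK; have := cone_inf_le _ _ sq Kq y _ K0.
    by rewrite /= addr0 subr0.
  have KP : sublinear (cone_inf q K) /\ forall y, cone_inf q K y <= p y.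
    by split=> // y; exact: le_trans (qp y).
  have /= := qmin (exist _ _ KP) _.
  have -> : le (exist _ q (conj sq qp)) (exist _ _ KP) by apply/asboolP.
  move=> /(_ isT)/(congr1 sval)/= KE.
  have Kx : K (x, q x) by exists 1; rewrite ?scale1r ?mul1r.
  have := cone_inf_le _ _ sq Kq (- x) _ Kx.
  by rewrite KE /= addNr (sublinear0 _ sq) sub0r.
exists q => // a x y.
have qZr b z : q (b *: z) = b * q z.
  have [b0|b0] := leP 0 b; first exact: qZ.
  rewrite -[b]opprK scaleNr qN qZ; last by rewrite oppr_ge0 ltW.
  by rewrite !mulNr.
have qDr u v : q (u + v) = q u + q v.
  apply/eqP; rewrite eq_le qD/= -lerBrDr.
  by have := qD (u + v) (- v); rewrite addrK qN; lra.
by rewrite qDr qZr.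
Qed.

End hahn_banach.

(** * Existence of continuous functionals *)

Lemma dual_of_linear {R : realType} {X : normedModType R} (f : X -> R) (M : R) :
  (forall a x y, f (a *: x + y) = a * f x + f y) ->
  (forall x, `|f x| <= M * `|x|) -> exists g : dual X, forall x, g x = f x.
Proof.
move=> lf fM; have fP : (f : X -> R^o) \in dual_pred X.
  apply/asboolP; split=> [a x y|x]; first exact: lf.
  (* A positive Lipschitz constant, whatever the sign of [M]. *)
  have M0 : 0 < `|M| + 1 by rewrite ltr_wpDl.
  apply/(@cvgrPdist_lt _ R^o) => e e0; near=> z.
  have -> : f x - f z = f (x - z).
    by rewrite [x - z]addrC -(scaleN1r z) lf; ring.
  apply: le_lt_trans (fM _) _; apply: (@le_lt_trans _ _ ((`|M| + 1) * `|x - z|)).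
    by apply: ler_wpM2r => //; have := ler_norm M; lra.
  rewrite mulrC -ltr_pdivlMr//; near: z.
  by apply: cvgr_dist_lt; rewrite ?divr_gt0//; exact: cvg_id.
by exists (Dual fP).
Unshelve. all: by end_near. Qed.

Lemma dual_normrP {R : realType} {X : normedModType R} (f : dual X) (x : X) :
  `|f x| <= `|f| * `|x|.
Proof. exact: dual_normP. Qed.

(** A linear minorant of [cone_inf] for the sublinear function [rho * |x|] is bounded by [rho] in
    norm and respects the constraints in [K]. *)
Lemma cone_sandwich {R : realType} {X : normedModType R} (rho : R)
    (K : set (X * R)) : 0 <= rho -> convex_cone K ->
  (forall k, K k -> k.2 <= rho * `|k.1|) ->
  exists2 f : dual X, `|f| <= rho & forall k, K k -> k.2 <= f k.1.
Proof.
move=> rho0 cK Krho.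
have sq : sublinear (fun x : X => rho * `|x|).
  split=> [x y|a x a0]; first by rewrite -mulrDr ler_wpM2l// ler_normD.
  by rewrite normrZ ger0_norm//; ring.
have [f lf fle] := sublinear_minorant _ (cone_inf_sublinear _ _ sq cK Krho).
have fN x : f (- x) = - f x.
  have f0 : f 0 = 0 by have := lf 1 0 0; rewrite scaler0 addr0; lra.
  by have := lf (-1) x 0; rewrite scaleN1r addr0 f0; lra.
have f_le x : f x <= rho * `|x|.
  have [K0 _ _] := cK; apply: le_trans (fle x) _.
  by have := cone_inf_le _ _ sq Krho x _ K0; rewrite /= addr0 subr0.
have fM x : `|f x| <= rho * `|x|.
  by rewrite ler_norml f_le andbT lerNl -fN -(normrN x) f_le.
have [g gE] := dual_of_linear _ _ lf fM; exists g.
  apply: dual_norm_le => x x1; rewrite gE; apply: le_trans (fM x) _.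
  by rewrite ler_piMr.
move=> k Kk; rewrite gE; have := fle (- k.1); rewrite fN.
have := cone_inf_le _ _ sq Krho (- k.1) _ Kk.
by rewrite addNr normr0 mulr0; lra.
Qed.

(** Sandwich along the ray through [(x, |x| ^+ 2)]; the result is a value at [x] of the duality
    map. *)
Lemma norming_functional {R : realType} {X : normedModType R} (x : X) :
  exists2 f : dual X, `|f| = `|x| & f x = `|x| ^+ 2.
Proof.
pose K : set (X * R) := [set k | exists2 a, 0 <= a & k = (a *: x, a * `|x| ^+ 2)].
have [||k|f fx fK] := @cone_sandwich _ _ `|x| K => //.
- split.
  + by exists 0; rewrite ?scale0r ?mul0r.
  + move=> _ _ [a a0 ->] [b b0 ->]; exists (a + b); first by rewrite addr_ge0.
    by rewrite scalerDl mulrDl.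
  + move=> a _ a0 [b b0 ->]; exists (a * b); first by rewrite mulr_ge0.
    by rewrite /= scalerA mulrA.
- move=> [a a0 ->] /=; rewrite normrZ ger0_norm// expr2.
  by rewrite mulrCA.
have lef : `|x| ^+ 2 <= f x by apply: (fK (x, _)); exists 1; rewrite ?scale1r ?mul1r.
have fle : f x <= `|f| * `|x| := le_trans (ler_norm _) (dual_normrP f x).
exists f.
  have [x0|x0] := eqVneq `|x| 0; first by apply/eqP; rewrite eq_le fx x0/=.
  apply/eqP; rewrite eq_le fx/=.
  have xp : 0 < `|x| by rewrite lt_neqAle eq_sym x0 normr_ge0.
  by rewrite -(ler_pM2r xp) -expr2; exact: le_trans fle.
apply/eqP; rewrite eq_le lef andbT; apply: le_trans fle _.
by rewrite expr2 ler_wpM2r.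
Qed.

(** * Completeness of a space and of its dual *)

(** A predicate on sequences, so that it applies alike to [X] and to [dual X], which is only given
    the structure of a normed module. *)
Definition cauchy_complete {R : realType} (V : normedModType R) : Prop :=
  forall u : nat -> V,
    (forall e : R, 0 < e -> exists N, forall m n,
       (N <= m)%N -> (N <= n)%N -> `|u m - u n| < e) ->
  exists l : V, u @ \oo --> l.

Lemma banach_cauchy_complete {R : realType} (V : completeNormedModType R) :
  cauchy_complete V.
Proof.
move=> u uC; apply/cvg_ex/cauchy_cvgP/cauchy_exP => e e0.
have [N uN] := uC e e0; exists (u N), N => // n /= Nn.
by rewrite -ball_normE /=; exact: uN.
Qed.

(** The limit [l] is taken pointwise. Letting [m] tend to infinity in the Cauchy estimate bounds
    [l - u n] uniformly on the unit ball, which gives both the boundedness of [l] and convergence in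
    norm. *)
Lemma dual_cauchy_complete {R : realType} (X : normedModType R) :
  cauchy_complete (dual X).
Proof.
move=> u uC.
have uxC x : exists l : R, (fun n => u n x : R^o) @ \oo --> (l : R^o).
  apply: (@banach_cauchy_complete _ R^o) => e e0.
  have x0 : 0 < `|x| + 1 by rewrite ltr_wpDl.
  have [|N uN] := uC (e / (`|x| + 1)); first by rewrite divr_gt0.
  exists N => m n Nm Nn; have := dual_normrP (u m - u n) x.
  rewrite [(u m - u n) x]/(u m x - u n x) => /le_lt_trans; apply.
  have := uN m n Nm Nn; rewrite ltr_pdivlMr//; apply: le_lt_trans.
  by rewrite ler_wpM2l// lerDl.
have [l lP] := choice uxC.
have luB e : 0 < e -> exists N, forall n x, (N <= n)%N ->
    `|l x - u n x| <= e * `|x|.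
  move=> e0; have [N uN] := uC e e0; exists N => n x Nn.
  have cv : `|(u m x : R^o) - u n x| @[m --> \oo] --> `|(l x : R^o) - u n x|.
    by apply: cvg_norm; apply: cvgB; [exact: lP|exact: cvg_cst].
  apply: (ler_cvg_to cv (cvg_cst (e * `|x|))).
  exists N => // m /= Nm; have := dual_normrP (u m - u n) x.
  rewrite [(u m - u n) x]/(u m x - u n x) => /le_trans; apply.
  by rewrite ler_wpM2r// ltW// uN.
have lin a x y : l (a *: x + y) = a * l x + l y.
  have c2 : (fun n => u n (a *: x + y) : R^o) @ \oo --> (a *: (l x : R^o) + l y : R^o).
    under eq_cvg do rewrite linearP.
    by apply: cvgD; [apply: cvgZr; exact: lP|exact: lP].
  exact: (cvg_unique _ (lP (a *: x + y)) c2).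
have [N luN] := luB 1 ltr01.
have [x|f fE] := dual_of_linear l (`|u N| + 1) lin.
  have := luN N x (leqnn _); have := dual_normrP (u N) x.
  have := ler_normD (l x - u N x) (u N x); rewrite subrK; lra.
exists f; apply/cvgrPdist_le => e e0; have [n luE] := luB e e0.
exists n => // m /= nm; apply: dual_norm_le => x x1.
rewrite [(f - u m) x]/(f x - u m x) fE; apply: le_trans (luE _ _ nm) _.
by rewrite ler_piMr// ltW.
Qed.

(** * Uniform convexity: convergence, norming vectors, smoothness of the squared norm *)

(** Nonnegativity of the midpoint defect; it lets a bound on the sum of two defects bound each of
    them. *)
Lemma half_normD_sqr {R : realType} {V : normedModType R} (x y : V) :
  `|2^-1 *: (x + y)| ^+ 2 <= 2^-1 * `|x| ^+ 2 + 2^-1 * `|y| ^+ 2.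
Proof.
rewrite normrZ ger0_norm ?invr_ge0//; have := ler_normD x y.
have := normr_ge0 (x + y); have := normr_ge0 x; have := normr_ge0 y.
move: `|x| `|y| `|x + y| => a b c b0 a0 c0 cab.
have : 0 <= (a + b - c) * (a + b + c) by rewrite mulr_ge0//; lra.
by have := sqr_ge0 (a - b); lra.
Qed.

(** If the norms of [x] and [y] differ by at least [e / 4], strict convexity of the real square
    suffices. Otherwise the normalised vectors are at least [e'] apart, and uniform convexity of the
    unit sphere applies. *)
Lemma uniformly_convex_sqr {R : realType} {V : normedModType R} :
  uniformly_convex V -> forall M e : R, 0 < M -> 0 < e ->
  exists2 d : R, 0 < d & forall x y : V, `|x| <= M -> `|y| <= M ->
    e <= `|x - y| ->
    `|2^-1 *: (x + y)| ^+ 2 <= 2^-1 * `|x| ^+ 2 + 2^-1 * `|y| ^+ 2 - d.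
Proof.
move=> uV M e M0 e0; pose e' := Num.min (e / (2 * M)) 2.
have e'0 : 0 < e' by rewrite lt_min divr_gt0 ?mulr_gt0//=.
have [|d' d'0 dP] := uV e' e'0; first by rewrite ge_min lexx orbT.
(* The first term is the gain for distant norms, the second the gain for nearby norms. *)
exists (Num.min (e ^+ 2 / 64) ((e * d' / 4) ^+ 2)).
  by rewrite lt_min divr_gt0 ?exprn_gt0 ?divr_gt0 ?mulr_gt0.
move=> x y; wlog xy : x y / `|y| <= `|x|.
  move=> H xM yM exy; have [yx|/ltW yx] := leP `|y| `|x|; first exact: H.
  by have := H y x yx yM xM; rewrite (distrC y) (addrC y) (addrC (_ * `|y| ^+ 2)); apply.
move=> xM yM exy; rewrite lerBrDr.
have [far|near] := leP (e / 4) (`|x| - `|y|).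
  apply: (@le_trans _ _ (`|2^-1 *: (x + y)| ^+ 2 + e ^+ 2 / 64)).
    by rewrite lerD2l ge_min lexx.
  rewrite normrZ ger0_norm ?invr_ge0//; have := ler_normD x y.
  have := normr_ge0 (x + y); have := normr_ge0 y.
  move: `|x| `|y| `|x + y| far e0 => a b c far e0 b0 c0 cab.
  have : 0 <= (a + b - c) * (a + b + c) by rewrite mulr_ge0//; lra.
  have : 0 <= (a - b - e / 4) * (a - b + e / 4) by rewrite mulr_ge0//; lra.
  by lra.
apply: (@le_trans _ _ (`|2^-1 *: (x + y)| ^+ 2 + (e * d' / 4) ^+ 2)).
  by rewrite lerD2l ge_min lexx orbT.
have tri := ler_normB x y.
have yp : e / 4 <= `|y| by lra.
have xn0 : `|x| != 0 by rewrite gt_eqF//; lra.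
have yn0 : `|y| != 0 by rewrite gt_eqF//; lra.
have unit z : `|z| != 0 -> exists2 z' : V, `|z'| = 1 & z = `|z| *: z'.
  move=> z0; exists (`|z|^-1 *: z); first by rewrite normrZ normfV normr_id mulVf.
  by rewrite scalerA mulfV// scale1r.
have [x' x'1 xE'] := unit x xn0; have [y' y'1 yE] := unit y yn0.
(* Splitting off a part of norm [|y|] from [x] lets the estimate on the sphere be scaled by one
   common factor; the remainder is shorter than [e / 4]. *)
have xE : x = `|y| *: x' + (`|x| - `|y|) *: x' by rewrite -scalerDl addrC subrK.
have e'xy : e' <= `|x' - y'|.
  rewrite ge_min; apply/orP; left; rewrite ler_pdivrMr ?mulr_gt0//.
  have : `|x - y| <= `|y| * `|x' - y'| + (`|x| - `|y|).
    have -> : x - y = `|y| *: (x' - y') + (`|x| - `|y|) *: x'.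
      by rewrite scalerBr -yE addrAC -xE.
    apply: le_trans (ler_normD _ _) _.
    by rewrite !normrZ normr_id x'1 mulr1 (ger0_norm (x := `|x| - `|y|))// subr_ge0.
  have := ler_wpM2r (normr_ge0 (x' - y')) yM; lra.
have := dP _ _ x'1 y'1 e'xy; rewrite normrZ ger0_norm ?invr_ge0// => mid.
have : `|x + y| <= `|y| * `|x' + y'| + (`|x| - `|y|).
  have -> : x + y = `|y| *: (x' + y') + (`|x| - `|y|) *: x'.
    by rewrite scalerDr -yE addrAC -xE.
  apply: le_trans (ler_normD _ _) _.
  by rewrite !normrZ normr_id x'1 mulr1 (ger0_norm (x := `|x| - `|y|))// subr_ge0.
have := ler_wpM2l (normr_ge0 y) mid.
rewrite normrZ ger0_norm ?invr_ge0//.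
have := normr_ge0 (x + y); have yd := ler_wpM2r (ltW d'0) yp.
move=> c0 h1 h2.
have {h1 h2} h : 2^-1 * `|x + y| <= (`|x| + `|y|) / 2 - e * d' / 4 by lra.
have d0 : 0 < e * d' / 4 by rewrite divr_gt0 ?mulr_gt0.
move: (e * d' / 4) h d0 c0 => d; move: `|x| `|y| `|x + y| => a b c h d0 c0.
have h2 : (2^-1 * c) ^+ 2 <= ((a + b) / 2 - d) ^+ 2.
  by rewrite ler_pXn2r// nnegrE; lra.
have := sqr_ge0 (a - b).
have : 0 <= d * ((a + b) / 2 - d) by rewrite mulr_ge0//; lra.
by lra.
Qed.

Lemma invSn_lt {R : realType} (e : R) : 0 < e ->
  exists N, forall n, (N <= n)%N -> n.+1%:R^-1 < e.
Proof.
move=> e0; have [N] := ltr_add_invr e0; rewrite add0r => NP.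
exists N => n Nn; apply: le_lt_trans NP.
by rewrite lef_pV2 ?posrE ?ltr0Sn// ler_nat.
Qed.

(** Points of a bounded set whose midpoint defect is small must be close, so extremising sequences
    are Cauchy. *)
Lemma uniformly_convex_cvg {R : realType} {V : normedModType R} :
  uniformly_convex V -> cauchy_complete V -> forall (M : R) (u : nat -> V),
  (forall n, `|u n| <= M) ->
  (forall e : R, 0 < e -> exists N, forall m n, (N <= m)%N -> (N <= n)%N ->
     2^-1 * `|u m| ^+ 2 + 2^-1 * `|u n| ^+ 2 - `|2^-1 *: (u m + u n)| ^+ 2 < e) ->
  exists l : V, u @ \oo --> l.
Proof.
move=> uV cV M u uM uC; apply: cV => e e0.
have M0 : 0 < M + 1 by rewrite ltr_wpDl// (le_trans _ (uM 0%N)).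
have [d d0 dP] := uniformly_convex_sqr uV _ _ M0 e0.
have [N uN] := uC d d0; exists N => m n Nm Nn; rewrite ltNge; apply/negP => emn.
have uM1 k : `|u k| <= M + 1 by have := uM k; lra.
by have := dP _ _ (uM1 m) (uM1 n) emn; have := uN _ _ Nm Nn; lra.
Qed.

(** Midpoints of a minimising sequence stay in [C], so their norms are at least [m] and the midpoint
    defects tend to [0]. *)
Lemma min_norm_exists {R : realType} {V : normedModType R} (C : set V) :
  uniformly_convex V -> cauchy_complete V -> C !=set0 ->
  (forall x y, C x -> C y -> C (2^-1 *: (x + y))) -> closed C ->
  exists2 x, C x & forall y, C y -> `|x| <= `|y|.
Proof.
move=> uV cV C0 Cmid clC; pose m := inf [set `|x| | x in C].
have lbm : has_lbound [set `|x| | x in C] by exists 0 => _ [x _ <-].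
have m_le x : C x -> m <= `|x| by move=> Cx; apply: ge_inf => //; exists x.
have m0 : 0 <= m by apply: lb_le_inf; [have [x Cx] := C0; exists `|x|, x|move=> _ [x _ <-]].
have : forall n : nat, exists x, C x /\ `|x| < m + n.+1%:R^-1.
  move=> n; have [||_ [x Cx <-] xlt] := @inf_adherent _ [set `|x| | x in C] n.+1%:R^-1.
  - by rewrite invr_gt0.
  - by split => //; have [x Cx] := C0; exists `|x|, x.
  by exists x.
move=> /choice[u uP]; have inv1 n : n.+1%:R^-1 <= 1 :> R by rewrite invf_le1// ler1n.
have [n|e e0|l ul] := uniformly_convex_cvg uV cV (m + 1) u.
- by have [_ un] := uP n; apply: ltW (lt_le_trans un _); rewrite lerD2l.
(* With excesses [s, t <= 1] over [m], the defect is at most [(s + t) (2 m + 1) / 2]. *)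
- have [|N NP] := invSn_lt (e / (2 * m + 1)); first by rewrite divr_gt0//; lra.
  exists N => i j Ni Nj.
  have [Ci ui] := uP i; have [Cj uj] := uP j.
  have := m_le _ (Cmid _ _ Ci Cj); have := NP _ Ni; have := NP _ Nj.
  have := inv1 i; have := inv1 j.
  have : 0 < i.+1%:R^-1 :> R by rewrite invr_gt0.
  have : 0 < j.+1%:R^-1 :> R by rewrite invr_gt0.
  have := m_le _ Ci; have := m_le _ Cj.
  rewrite !ltr_pdivlMr; try lra.
  move: `|_ *: _| `|u i| `|u j| (i.+1%:R^-1) (j.+1%:R^-1) ui uj => k a b s t.
  move=> ha hb mb ma t0 s0 t1 s1 ht hs mk.
  have : 0 <= (m + s - a) * (m + s + a) by rewrite mulr_ge0//; lra.
  have : 0 <= (m + t - b) * (m + t + b) by rewrite mulr_ge0//; lra.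
  have : 0 <= (k - m) * (k + m) by rewrite mulr_ge0//; lra.
  have : 0 <= s * (1 - s) by rewrite mulr_ge0//; lra.
  have : 0 <= t * (1 - t) by rewrite mulr_ge0//; lra.
  by lra.
exists l.
  by apply: (closed_cvg C clC _ _ ul); apply: nearW => n; exact: (uP n).1.
move=> y Cy; apply: le_trans (m_le _ Cy).
have lm : m + n.+1%:R^-1 @[n --> \oo] --> m.
  by rewrite -[X in _ --> X]addr0; apply: cvgD; [exact: cvg_cst|exact: cvg_harmonic].
apply: (ler_cvg_to (cvg_norm ul) lm).
by apply: nearW => n; apply: ltW; exact: (uP n).2.
Qed.

(** The form of reflexivity used below: a sequence in the unit ball along which [f] tends to its
    norm has midpoints of norm close to [1], hence converges, and its limit is rescaled by [|f|]. *)
Lemma norming_vector {R : realType} {X : normedModType R} (f : dual X) :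
  uniformly_convex X -> cauchy_complete X ->
  exists2 v : X, `|v| = `|f| & f v = `|f| ^+ 2.
Proof.
move=> uX cX; have [f0|fn0] := eqVneq `|f| 0.
  by exists 0; rewrite ?linear0 f0 ?normr0// expr0n.
have fp : 0 < `|f| by rewrite lt_neqAle eq_sym fn0 normr_ge0.
have : forall n : nat, exists x, `|x| <= 1 /\ `|f| - n.+1%:R^-1 < f x.
  move=> n; have n0 : 0 < n.+1%:R^-1 :> R by rewrite invr_gt0.
  have [_ [x /= x1 <-]] := sup_adherent n0 (dual_norm_has_sup f).
  rewrite -[sup _]/(`|f|) => xlt; have [fx|fx] := leP 0 (f x).
    by exists x; rewrite ger0_norm in xlt.
  by exists (- x); rewrite normrN linearN; rewrite ltr0_norm in xlt.
move=> /choice[u uP].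
have fle x : f x <= `|f| * `|x| := le_trans (ler_norm _) (dual_normrP f x).
have [n|e e0|l ul] := uniformly_convex_cvg uX cX 1 u.
- exact: (uP n).1.
(* If the midpoint has norm [k], its value under [f] gives [2 (1 - k) < e], and the defect is at
   most [1 - k ^+ 2 <= 2 (1 - k)]. *)
- have [|N NP] := invSn_lt (e * `|f| / 2); first by rewrite divr_gt0// mulr_gt0.
  exists N => i j Ni Nj; have [ui1 ui] := uP i; have [uj1 uj] := uP j.
  have := fle (2^-1 *: (u i + u j)); rewrite linearZ linearD /=.
  rewrite -[2^-1 *: (_ : R^o)]/(2^-1 * _).
  have := NP _ Ni; have := NP _ Nj; have := normr_ge0 (u i); have := normr_ge0 (u j).
  move: `|_ *: _| `|u i| `|u j| (i.+1%:R^-1) (j.+1%:R^-1) ui1 uj1 ui uj.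
  move=> k a b s t a1 b1 Hs Ht b0 a0 Hj Hi hk.
  have hk' : `|f| * (2 * (1 - k)) < `|f| * e by lra.
  move: hk'; rewrite ltr_pM2l// => hk'.
  have : 0 <= (1 - a) * (1 + a) by rewrite mulr_ge0//; lra.
  have : 0 <= (1 - b) * (1 + b) by rewrite mulr_ge0//; lra.
  by have := sqr_ge0 (1 - k); lra.
have l1 : `|l| <= 1.
  apply: (ler_cvg_to (cvg_norm ul) (cvg_cst (1 : R))).
  by apply: nearW => n; exact: (uP n).1.
have fl : `|f| <= f l.
  have ful : (fun n => f (u n) : R^o) @ \oo --> (f l : R^o).
    by apply: cvg_comp ul _; exact: dual_continuous.
  have lm : `|f| - n.+1%:R^-1 @[n --> \oo] --> `|f|.
    by rewrite -[X in _ --> X]subr0; apply: cvgB; [exact: cvg_cst|exact: cvg_harmonic].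
  by apply: (ler_cvg_to lm ful); apply: nearW => n; apply: ltW; exact: (uP n).2.
have fll := fle l.
have l1' : `|l| = 1.
  apply/eqP; rewrite eq_le l1/= -(ler_pM2l fp) mulr1; exact: le_trans fll.
exists (`|f| *: l); first by rewrite normrZ normr_id l1' mulr1.
rewrite linearZ /= -[_ *: _]/(`|f| * f l) expr2; congr (_ * _).
by apply/eqP; rewrite eq_le fl andbT; rewrite l1' mulr1 in fll.
Qed.

(* The norming functionals of [x + s *: h] converge to [j] as [s] tends to [0],
   by uniform convexity of the space [W] in which they live; [W] is the dual of
   [V] or its predual. *)
Lemma sqr_norm_expansion {R : realType} {V W : normedModType R}
    (b : W -> V -> R) :
  (forall a w w' v, b (a *: w + w') v = a * b w v + b w' v) ->
  (forall a w v v', b w (a *: v + v') = a * b w v + b w v') ->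
  (forall w v, b w v <= `|w| * `|v|) ->
  (forall v, exists2 w, `|w| = `|v| & b w v = `|v| ^+ 2) ->
  uniformly_convex W ->
  forall (x h : V) (j : W) (e : R), `|j| = `|x| -> b j x = `|x| ^+ 2 -> 0 < e ->
  exists2 s0 : R, 0 < s0 & forall s, 0 < s -> s <= s0 ->
    2^-1 * `|x + s *: h| ^+ 2 <= 2^-1 * `|x| ^+ 2 + s * (b j h + e).
Proof.
move=> bl br bn bJ uW x h j e jx bjx e0.
pose M := `|x| + `|h| + 1.
have [x0 h0] : 0 <= `|x| /\ 0 <= `|h| by [].
have M0 : 0 < M by rewrite /M; lra.
have h1 : 0 < `|h| + 1 by lra.
have [d d0 dP] := uniformly_convex_sqr uW _ _ M0 (divr_gt0 e0 h1).
have d1 : 0 < d / (4 * M * (`|h| + 1)) by rewrite divr_gt0 ?mulr_gt0.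
exists (Num.min 1 (d / (4 * M * (`|h| + 1)))); first by rewrite lt_min ltr01.
move=> s sp; rewrite le_min ler_pdivlMr ?mulr_gt0// => /andP[s1 sd].
have [j' j'x bj'] := bJ (x + s *: h).
have bE : b j' x = `|x + s *: h| ^+ 2 - s * b j' h.
  by rewrite -bj' [x + _]addrC br; lra.
have xs : `|x + s *: h| <= `|x| + s * `|h|.
  by apply: le_trans (ler_normD _ _) _; rewrite normrZ gtr0_norm.
have xs' : `|x| <= `|x + s *: h| + s * `|h|.
  have := ler_normB (x + s *: h) (s *: h).
  by rewrite addrK normrZ gtr0_norm.
have sh : s * `|h| <= `|h| by rewrite ler_piMl.
have xsM : `|x + s *: h| <= M by rewrite /M; lra.
have bjh := bn j' h; have bjx' := bn j' x.
have bNl w w' v : b (w - w') v = b w v - b w' v.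
  by rewrite addrC -scaleN1r bl; lra.
(* Testing the midpoint of [j'] and [j] against [x] bounds its squared norm below by
   [|x + s *: h| ^+ 2 - s * b j' h]. Were [j'] and [j] far apart, it would lie at least [d] below
   the mean of their squared norms; the bound on [s] excludes this. *)
have close : `|j' - j| < e / (`|h| + 1).
  rewrite ltNge; apply/negP => far.
  have := dP j' j; rewrite j'x jx => /(_ xsM _ far); rewrite /M.
  have -> : `|x| <= `|x| + `|h| + 1 by lra.
  move=> /(_ isT) kle.
  have := bn (2^-1 *: (j' + j)) x.
  have -> : b (2^-1 *: (j' + j)) x = 2^-1 * (b j' x + b j x).
    have b0 : b 0 x = 0 by have := bl 1 0 0 x; rewrite scaler0 addr0; lra.
    have := bl 2^-1 (j' + j) 0 x; rewrite addr0 b0 addr0 => ->.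
    by have := bl 1 j' j x; rewrite scale1r mul1r => ->.
  rewrite bE bjx; rewrite j'x in bjh.
  move: kle; move: `|2^-1 *: _| => k kle hk.
  have kx := sqr_ge0 (k - `|x|).
  have h2 : s * b j' h <= s * (M * `|h|).
    by rewrite ler_wpM2l ?(ltW sp)//; apply: le_trans bjh _; rewrite ler_wpM2r.
  have h3 : 0 <= (`|x + s *: h| + s * `|h| - `|x|) * (`|x| + `|x + s *: h|).
    by apply: mulr_ge0; [lra|exact: addr_ge0].
  have h4 : s * `|h| * (`|x| + `|x + s *: h|) <= s * `|h| * (2 * M).
    by rewrite ler_wpM2l ?mulr_ge0 ?(ltW sp)//; rewrite /M in xsM *; lra.
  have h5 : s * (M * (`|h|)) <= s * (M * (`|h| + 1)) .
    by rewrite ler_pM2l// ler_pM2l//; lra.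
  lra.
have := bn (j' - j) h; rewrite bNl => h1'.
have h2 : `|j' - j| * `|h| <= e.
  apply: le_trans (ler_wpM2r h0 (ltW close)) _.
  by rewrite mulrAC ler_pdivrMr// ler_pM2l//; lra.
have h3 : s * b j' h <= s * (b j h + e) by rewrite ler_pM2l//; lra.
(* By [|x + s *: h| * |x| <= (|x + s *: h| ^+ 2 + |x| ^+ 2) / 2], half the squared norm grows by at
   most [s * b j' h]. *)
rewrite bE j'x in bjx'.
have := sqr_ge0 (`|x + s *: h| - `|x|); lra.
Qed.

(** * Evaluation of functionals *)

Section dual_pairing.
Context {R : realType} {X : normedModType R}.
Implicit Types (f g : dual X) (x y : X).

Lemma dualD f x y : f (x + y) = f x + f y :> R. Proof. exact: linearD. Qed.
Lemma dualN f x : f (- x) = - f x :> R. Proof. exact: linearN. Qed.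
Lemma dualB f x y : f (x - y) = f x - f y :> R. Proof. exact: linearB. Qed.
Lemma dualZ f a x : f (a *: x) = a * f x :> R. Proof. exact: linearZ. Qed.
Lemma add_dualE f g x : (f + g) x = f x + g x :> R. Proof. by []. Qed.
Lemma opp_dualE f x : (- f) x = - f x :> R. Proof. by []. Qed.
Lemma sub_dualE f g x : (f - g) x = f x - g x :> R. Proof. by []. Qed.
Lemma scale_dualE a f x : (a *: f) x = a * f x :> R. Proof. by []. Qed.

Definition dualE :=
  (dualD, dualN, dualZ, add_dualE, opp_dualE, sub_dualE, scale_dualE).

Lemma dual_le f x : f x <= `|f| * `|x|.
Proof. exact: le_trans (ler_norm _) (dual_normrP f x). Qed.

Lemma dual_ge f x : - (`|f| * `|x|) <= f x.
Proof. by have := dual_le f (- x); rewrite dualN normrN; lra. Qed.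

Lemma dual_eval_cvg (u : nat -> dual X) f x : u @ \oo --> f ->
  (fun n => u n x : R^o) @ \oo --> (f x : R^o).
Proof.
move=> /cvgrPdist_lt uf; apply/(@cvgrPdist_lt _ R^o) => e e0.
have x0 : 0 < `|x| + 1 by rewrite ltr_wpDl.
have [N _ NP] := uf _ (divr_gt0 e0 x0); exists N => // n /NP /=.
rewrite ltr_pdivlMr// => nlt; rewrite -[_ - _]/((f - u n) x).
apply: le_lt_trans (dual_normrP _ _) _; apply: le_lt_trans nlt.
by rewrite ler_wpM2l// lerDl.
Qed.

End dual_pairing.

Lemma midpointE {R : realType} {V : lmodType R} (x y : V) :
  x + 2^-1 *: (y - x) = 2^-1 *: (x + y).
Proof.
have {1}-> : x = 2^-1 *: (x + x).
  by rewrite scalerDr -scalerDl (_ : _ + _ = 1) ?scale1r//; lra.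
by rewrite -scalerDr addrACA addrN addr0 addrC.
Qed.

(** * The Fitzpatrick function and the duality map *)

Section surjectivity.
Context {R : realType} {X : normedModType R}.
Variables (A : X -> set (dual X)).
Hypotheses (uX : uniformly_convex X) (uX' : uniformly_convex (dual X)).
Hypothesis cX : cauchy_complete X.
Hypothesis monoA : monotone_op A.
Hypothesis maxA : forall p (p' : dual X),
  (forall a a', A a a' -> 0 <= pairing (a' - p') (a - p)) -> A p p'.

(** The epigraph of the Fitzpatrick function of [A]; working with the epigraph avoids infinite
    values. *)
Definition fitzpatrick_epi (x : X) (x' : dual X) (t : R) : Prop :=
  forall a a', A a a' -> a' x + x' a - a' a <= t.

Lemma fitzpatrick_graph a a' : A a a' -> fitzpatrick_epi a a' (a' a).
Proof.
move=> Aa c c' Ac; have := monoA _ _ _ _ Aa Ac.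
by rewrite /pairing dualB !dualE; lra.
Qed.

(** If [t < x' x], the constraints make [(x, x')] monotonically related to the graph, hence a member
    of it, and the constraint at that very point reads [x' x <= t]. *)
Lemma fitzpatrick_ge x x' t : fitzpatrick_epi x x' t -> x' x <= t.
Proof.
move=> Ex; rewrite leNgt; apply/negP => tlt.
have Ax : A x x'.
  apply: maxA => a a' Aa; have := Ex _ _ Aa.
  by rewrite /pairing dualB !dualE; lra.
by have := Ex _ _ Ax; lra.
Qed.

Lemma fitzpatrick_convex x x' t y y' t' s : 0 <= s -> s <= 1 ->
  fitzpatrick_epi x x' t -> fitzpatrick_epi y y' t' ->
  fitzpatrick_epi (x + s *: (y - x)) (x' + s *: (y' - x')) (t + s * (t' - t)).
Proof.
move=> s0 s1 Ex Ey a a' Aa; rewrite !dualE.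
have h1 : 0 <= (1 - s) * (t - (a' x + x' a - a' a)).
  by rewrite mulr_ge0 ?subr_ge0// Ex.
have h2 : 0 <= s * (t' - (a' y + y' a - a' a)).
  by rewrite mulr_ge0 ?subr_ge0// Ey.
by lra.
Qed.

Definition fitzpatrick_energy (x : X) (x' : dual X) (t : R) : R :=
  t + 2^-1 * `|x| ^+ 2 + 2^-1 * `|x'| ^+ 2.

Lemma fitzpatrick_energy_ge0 x x' t : fitzpatrick_epi x x' t ->
  0 <= fitzpatrick_energy x x' t.
Proof.
move=> /fitzpatrick_ge xt; rewrite /fitzpatrick_energy.
by have := dual_ge x' x; have := sqr_ge0 (`|x| - `|x'|); lra.
Qed.

(** Midpoints of a minimising sequence remain in the epigraph, so the sum of the defects in [X] and
    in [dual X] tends to [0]. *)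
Lemma fitzpatrick_energy_min : (exists a, A a !=set0) ->
  exists x x' t, fitzpatrick_epi x x' t /\
    forall y y' t', fitzpatrick_epi y y' t' ->
      fitzpatrick_energy x x' t <= fitzpatrick_energy y y' t'.
Proof.
move=> [a0 [a0' Aa0]].
pose G : set R := [set r | exists x x' t, fitzpatrick_epi x x' t /\
  fitzpatrick_energy x x' t = r].
have G0 : G !=set0.
  exists (fitzpatrick_energy a0 a0' (a0' a0)), a0, a0', (a0' a0).
  by split => //; exact: fitzpatrick_graph.
have lbG : has_lbound G.
  by exists 0 => _ [x [x' [t [Ex <-]]]]; exact: fitzpatrick_energy_ge0.
pose m := inf G.
have m_le x x' t : fitzpatrick_epi x x' t -> m <= fitzpatrick_energy x x' t.
  by move=> Ex; apply: ge_inf => //; exists x, x', t.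
have : forall n : nat, exists w : X * dual X * R,
    fitzpatrick_epi w.1.1 w.1.2 w.2 /\
    fitzpatrick_energy w.1.1 w.1.2 w.2 < m + n.+1%:R^-1.
  move=> n; have [||_ [x [x' [t [Ex <-]]]] lt] := @inf_adherent _ G n.+1%:R^-1.
  - by rewrite invr_gt0.
  - by split.
  by exists (x, x', t).
move=> /choice[w wP].
pose u n := (w n).1.1; pose u' n := (w n).1.2; pose t n := (w n).2.
have Eu n : fitzpatrick_epi (u n) (u' n) (t n) := (wP n).1.
have gu n : t n + 2^-1 * `|u n| ^+ 2 + 2^-1 * `|u' n| ^+ 2 < m + n.+1%:R^-1 :=
  (wP n).2.
have mmid i j : m <= t i + 2^-1 * (t j - t i) +
    2^-1 * `|2^-1 *: (u i + u j)| ^+ 2 + 2^-1 * `|2^-1 *: (u' i + u' j)| ^+ 2.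
  rewrite -(midpointE (u i)) -(midpointE (u' i)).
  apply: (m_le); apply: fitzpatrick_convex => //.
  by rewrite invf_le1// ler1n.
have inv1 n : n.+1%:R^-1 <= 1 :> R by rewrite invf_le1// ler1n.
(* The constraint at the graph point [(a0, a0')] bounds [t n] below by an affine function of
   [(u n, u' n)], which the quadratic terms absorb. *)
have [M uM uM'] : exists2 M, forall n, `|u n| <= M & forall n, `|u' n| <= M.
  pose Q := m + 1 + a0' a0 + `|a0'| ^+ 2 + `|a0| ^+ 2.
  have uQ n : 4^-1 * `|u n| ^+ 2 + 4^-1 * `|u' n| ^+ 2 <= Q.
    have := Eu n _ _ Aa0; have := gu n; have := inv1 n.
    have := dual_ge a0' (u n); have := dual_ge (u' n) a0.
    have := sqr_ge0 (2^-1 * `|u n| - `|a0'|).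
    have := sqr_ge0 (2^-1 * `|u' n| - `|a0|).
    by rewrite /Q; move: (n.+1%:R^-1) => s; lra.
  exists (2 * Q + 1) => n; have := uQ n.
    by have := sqr_ge0 `|u' n|; have := sqr_ge0 (`|u n| - 1); lra.
  by have := sqr_ge0 `|u n|; have := sqr_ge0 (`|u' n| - 1); lra.
have uC (e : R) : 0 < e -> exists N, forall i j, (N <= i)%N -> (N <= j)%N ->
    (2^-1 * `|u i| ^+ 2 + 2^-1 * `|u j| ^+ 2 - `|2^-1 *: (u i + u j)| ^+ 2) +
    (2^-1 * `|u' i| ^+ 2 + 2^-1 * `|u' j| ^+ 2 - `|2^-1 *: (u' i + u' j)| ^+ 2)
    < e.
  move=> e0; have [|N NP] := invSn_lt (e / 2); first by rewrite divr_gt0.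
  exists N => i j /NP Ni /NP Nj; have := mmid i j; have := gu i; have := gu j.
  move: (i.+1%:R^-1) (j.+1%:R^-1) Ni Nj => r s; lra.
have [|e /uC[N NP]|x ux] := uniformly_convex_cvg uX cX M u => //.
  exists N => i j Ni Nj; have := NP i j Ni Nj.
  by have := half_normD_sqr (u' i) (u' j); lra.
have [|e /uC[N NP]|x' ux'] :=
    uniformly_convex_cvg uX' (dual_cauchy_complete X) M u' => //.
  exists N => i j Ni Nj; have := NP i j Ni Nj.
  by have := half_normD_sqr (u i) (u j); lra.
(* The last coordinate is chosen to make the energy equal to [m]; the constraints then follow by
   passing to the limit. *)
exists x, x', (m - 2^-1 * `|x| ^+ 2 - 2^-1 * `|x'| ^+ 2); split; last first.
  by move=> y y' t' /m_le; rewrite /fitzpatrick_energy; lra.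
move=> a a' Aa; suff : a' x + x' a - a' a + 2^-1 * `|x| ^+ 2 + 2^-1 * `|x'| ^+ 2 <= m
  by lra.
have lm : m + n.+1%:R^-1 @[n --> \oo] --> m.
  by rewrite -[X in _ --> X]addr0; apply: cvgD; [exact: cvg_cst|exact: cvg_harmonic].
have sqr_cvg (v : nat -> R) (l : R) : v @ \oo --> l ->
    2^-1 * v n ^+ 2 @[n --> \oo] --> 2^-1 * l ^+ 2.
  move=> vl; rewrite expr2; under eq_cvg do rewrite expr2.
  by apply: cvgM; [exact: cvg_cst|exact: cvgM].
have lhs : a' (u n) + u' n a - a' a + 2^-1 * `|u n| ^+ 2 + 2^-1 * `|u' n| ^+ 2
    @[n --> \oo] --> a' x + x' a - a' a + 2^-1 * `|x| ^+ 2 + 2^-1 * `|x'| ^+ 2.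
  apply: cvgD; last by apply: sqr_cvg; exact: cvg_norm.
  apply: cvgD; last by apply: sqr_cvg; exact: cvg_norm.
  apply: cvgB; last exact: cvg_cst.
  apply: cvgD; last exact: dual_eval_cvg.
  by apply: cvg_comp ux _; exact: dual_continuous.
apply: (ler_cvg_to lhs lm); apply: nearW => n.
by have := Eu n _ _ Aa; have := gu n; move: (n.+1%:R^-1) => s; lra.
Qed.

(* At the minimiser, the two norming elements [j] and [k] satisfy
   [(a' + j) (a + k) >= 0] along the graph of [A], so maximality puts
   [(- k, - j)] in the graph, which forces equality everywhere. *)
Lemma zero_in_range_duality : (exists a, A a !=set0) ->
  exists p p', [/\ A p p', `|p'| = `|p| & p' p = - `|p| ^+ 2 :> R].
Proof.
move=> /fitzpatrick_energy_min[x [x' [t [Ex xmin]]]].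
have [j jx jE] := norming_functional x.
have [k kx kE] := norming_vector x' uX cX.
(* Move from the minimiser a fraction [s] of the way to [(a, a')], compare energies and divide by
   [s]; each squared norm contributes an error [e / 2]. *)
have first_order a a' : A a a' ->
    0 <= a' a - t + j (a - x) + (a' - x') k.
  move=> Aa; rewrite -lerBlDr sub0r; apply/ler_addgt0Pr => e e0.
  have e2 : 0 < e / 2 by rewrite divr_gt0.
  have expand : exists2 s1 : R, 0 < s1 & forall s, 0 < s -> s <= s1 ->
      2^-1 * `|x + s *: (a - x)| ^+ 2 <=
      2^-1 * `|x| ^+ 2 + s * (j (a - x) + e / 2).
    apply: (@sqr_norm_expansion _ X (dual X) (fun w v => w v)) => //.
    - by move=> ? ? ? ?; rewrite !dualE.
    - by move=> ? ?; exact: dual_le.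
    - exact: norming_functional.
  have expand' : exists2 s2 : R, 0 < s2 & forall s, 0 < s -> s <= s2 ->
      2^-1 * `|x' + s *: (a' - x')| ^+ 2 <=
      2^-1 * `|x'| ^+ 2 + s * ((a' - x') k + e / 2).
    apply: (@sqr_norm_expansion _ (dual X) X (fun w v => v w)) => //.
    - by move=> ? ? ? ?; rewrite !dualE.
    - by move=> ? ?; rewrite mulrC; exact: dual_le.
    - by move=> v; exact: norming_vector.
  have [s1 s10 s1P] := expand; have [s2 s20 s2P] := expand'.
  pose s := Num.min 1 (Num.min s1 s2).
  have s0 : 0 < s by rewrite !lt_min ltr01 s10.
  have sle1 : s <= 1 by rewrite ge_min lexx.
  have := xmin _ _ _ (fitzpatrick_convex _ _ _ _ _ _ s (ltW s0) sle1 Ex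
    (fitzpatrick_graph _ _ Aa)).
  have ss1 : s <= s1 by rewrite !ge_min lexx !orbT.
  have ss2 : s <= s2 by rewrite !ge_min lexx !orbT.
  have := s1P s s0 ss1; have := s2P s s0 ss2; rewrite /fitzpatrick_energy.
  move=> h2 h1 h.
  have : 0 <= s * (a' a - t + j (a - x) + (a' - x') k + e) by lra.
  by rewrite pmulr_rge0//; lra.
have xt := fitzpatrick_ge _ _ _ Ex; have x'x := dual_ge x' x.
have jk := dual_ge j k; rewrite jx kx in jk.
(* Complete the product by adding [j k], and use [x' x <= t]. *)
have lower a a' : A a a' ->
    x' x + `|x| ^+ 2 + `|x'| ^+ 2 + j k <= (a' + j) (a + k).
  move=> /first_order; rewrite dualB !dualE jE kE; lra.
have Ap : A (- k) (- j).
  apply: maxA => a a' /lower; rewrite /pairing !opprK.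
  by have := sqr_ge0 (`|x| - `|x'|); lra.
have := lower _ _ Ap; rewrite addNr -[(0 : dual X) _]/(0 : R) => le0.
have xx' : `|x| = `|x'|.
  have : (`|x| - `|x'|) ^+ 2 <= 0 by lra.
  move=> h; have /eqP : (`|x| - `|x'|) ^+ 2 = 0 by apply/eqP; rewrite eq_le h sqr_ge0.
  by rewrite sqrf_eq0 subr_eq0 => /eqP.
exists (- k), (- j); split => //; first by rewrite !normrN jx kx.
rewrite !dualE opprK normrN kx -xx'; rewrite -xx' in le0 jk x'x; lra.
Qed.

End surjectivity.

(** * Domain and values of a maximal monotone operator *)

Lemma closure_normP {R : realType} {V : normedModType R} (S : set V) (x : V) :
  closure S x <-> forall e : R, 0 < e -> exists2 y, S y & `|x - y| < e.
Proof.
split=> [clS e e0|H B /nbhs_ballP[e e0 eB]].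
  have [y [Sy]] := clS _ (nbhsx_ballx x e e0).
  by rewrite -ball_normE => xy; exists y.
have [y Sy xy] := H e e0; exists y; split => //; apply: eB.
by rewrite -ball_normE.
Qed.

Section maximal_monotone.
Context {R : realType} {X : completeNormedModType R}.
Variable A : X -> set (dual X).
Hypotheses (uX : uniformly_convex X) (uX' : uniformly_convex (dual X)).
Hypothesis maxA : maximal_monotone A.

(** Adjoining a related pair [(p, p')] to the graph keeps it monotone, so a pair outside the graph
    would contradict maximality. *)
Lemma maximal_monotone_related p (p' : dual X) :
  (forall a a', A a a' -> 0 <= pairing (a' - p') (a - p)) -> A p p'.
Proof.
move=> rel; apply: contrapT => nA; have [monoA max] := maxA.
apply: (max (fun a => A a `|` [set a' | a = p /\ a' = p'])).
  move=> a b a' b' [Aa|[-> ->]] [Ab|[-> ->]].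
  - exact: monoA.
  - exact: rel.
  - have := rel _ _ Ab; rewrite /pairing !dualB !sub_dualE; lra.
  - by rewrite /pairing !dualB !sub_dualE; lra.
split; first by move=> [a a'] /= Aa; left.
by move=> /(_ (p, p')) /= H; apply: nA; apply: H; right.
Qed.

(** [zero_in_range_duality] for the translated and scaled operator [B q = lam A (q + u)]; of the
    duality relation only the identity used below is kept. *)
Lemma maximal_monotone_resolvent (u : X) (lam : R) : 0 < lam ->
  op_domain A !=set0 ->
  exists p p', A p p' /\ p' (p - u) = - (lam^-1 * `|p - u| ^+ 2) :> R.
Proof.
move=> lam0 [a [a' Aa]]; have [monoA _] := maxA.
pose B q : set (dual X) := [set q' | A (q + u) (lam^-1 *: q')].
have BE (q r : X) (q' r' : dual X) :
    pairing (lam^-1 *: q' - lam^-1 *: r') (q + u - (r + u)) =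
    lam^-1 * pairing (q' - r') (q - r).
  by rewrite /pairing !dualB !dualD !sub_dualE !scale_dualE; lra.
have lamV : 0 < lam^-1 by rewrite invr_gt0.
have [||||p [p' [Bp _ pE]]] := @zero_in_range_duality _ X B uX uX' _ _ _ _.
- exact: banach_cauchy_complete.
- by move=> q r q' r' Bq Br; have := monoA _ _ _ _ Bq Br; rewrite BE pmulr_rge0.
- move=> p p' rel; apply: maximal_monotone_related => b b' Ab.
  have lamK : lam^-1 *: (lam *: b') = b' by rewrite scalerA mulVf ?gt_eqF// scale1r.
  have := BE (b - u) p (lam *: b') p'; rewrite subrK lamK => ->.
  by rewrite pmulr_rge0//; apply: rel; rewrite /B /= subrK lamK.
- by exists (a - u), (lam *: a'); rewrite /B /= subrK scalerA mulVf ?gt_eqF// scale1r.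
exists (p + u), (lam^-1 *: p'); split => //.
by rewrite addrK scale_dualE pE mulrN.
Qed.

(** Monotonicity of the resolvent point [p] against [a] and [b], weighted by [1 - s] and [s], gives
    [lam^-1 * |p - u| ^+ 2 <= C * |p - u| + D], so [p] is close to [u] for small [lam]. *)
Lemma segment_closure_domain (a b : X) (s : R) :
  op_domain A a -> op_domain A b -> 0 <= s -> s <= 1 ->
  closure (op_domain A) (a + s *: (b - a)).
Proof.
move=> Da Db s0 s1; apply/closure_normP => e e0.
have [a' Aa] := Da; have [b' Ab] := Db; have [monoA _] := maxA.
set u := a + _.
pose C := `|a'| + `|b'|; pose D := `|a'| * `|u - a| + `|b'| * `|u - b|.
have C0 : 0 <= C by rewrite addr_ge0.
have D0 : 0 <= D by rewrite addr_ge0 ?mulr_ge0.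
have K0 : 0 <= C + D / e by rewrite addr_ge0// divr_ge0// ltW.
have K1 : 0 < C + D / e + 1 by rewrite ltr_wpDl.
(* If [|p - u| >= e], then [D <= D / e * |p - u|], whence [|p - u| <= lam * (C + D / e)]; this [lam]
   makes the right side smaller than [e]. *)
pose lam := e / (C + D / e + 1).
have lam0 : 0 < lam by rewrite divr_gt0.
have [||p [p' [Ap pE]]] := maximal_monotone_resolvent u lam => //; first by exists a.
exists p; first by exists p'.
rewrite distrC ltNge; apply/negP => ed.
have ha := monoA _ _ _ _ Ap Aa; have hb := monoA _ _ _ _ Ap Ab.
have la : a' (p - a) >= - (`|a'| * (`|p - u| + `|u - a|)).
  apply: le_trans (dual_ge _ _); rewrite lerN2 ler_wpM2l//.
  by have := ler_normD (p - u) (u - a); rewrite addrA subrK.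
have lb : b' (p - b) >= - (`|b'| * (`|p - u| + `|u - b|)).
  apply: le_trans (dual_ge _ _); rewrite lerN2 ler_wpM2l//.
  by have := ler_normD (p - u) (u - b); rewrite addrA subrK.
have comb : 0 <= (1 - s) * pairing (p' - a') (p - a) + s * pairing (p' - b') (p - b).
  by rewrite addr_ge0// mulr_ge0// subr_ge0.
have uE : p' (p - u) = (1 - s) * p' (p - a) + s * p' (p - b) :> R.
  by rewrite /u !dualB !dualD !dualZ !dualB; ring.
have T0 : 0 <= `|a'| * (`|p - u| + `|u - a|) by rewrite mulr_ge0 ?addr_ge0.
have T1 : 0 <= `|b'| * (`|p - u| + `|u - b|) by rewrite mulr_ge0 ?addr_ge0.
have bound : lam^-1 * `|p - u| ^+ 2 <= C * `|p - u| + D.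
  have h1 : 0 <= (1 - s) * (a' (p - a) + `|a'| * (`|p - u| + `|u - a|)).
    by rewrite mulr_ge0 ?subr_ge0//; lra.
  have h2 : 0 <= s * (b' (p - b) + `|b'| * (`|p - u| + `|u - b|)).
    by rewrite mulr_ge0//; lra.
  have h3 : 0 <= s * (`|a'| * (`|p - u| + `|u - a|)) by rewrite mulr_ge0.
  have h4 : 0 <= (1 - s) * (`|b'| * (`|p - u| + `|u - b|)).
    by rewrite mulr_ge0 ?subr_ge0.
  rewrite /pairing !sub_dualE in comb; rewrite pE in uE.
  by rewrite /C /D; lra.
have Dd : D <= D / e * `|p - u|.
  by rewrite mulrAC -mulrA ler_peMr// ler_pdivlMr// mul1r.
have dp : 0 < `|p - u| by exact: lt_le_trans ed.
have : lam^-1 * `|p - u| * `|p - u| <= (C + D / e) * `|p - u|.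
  by rewrite -mulrA -expr2; lra.
rewrite ler_pM2r// ler_pdivrMl// => dle.
have : lam * (C + D / e) < e.
  by rewrite /lam mulrAC ltr_pdivrMr// ltr_pM2l// ltrDl.
by move: dle ed; move: `|p - u| (lam * _) => d L; lra.
Qed.

Lemma closure_domain_convex (a b : X) (s : R) :
  closure (op_domain A) a -> closure (op_domain A) b -> 0 <= s -> s <= 1 ->
  closure (op_domain A) (a + s *: (b - a)).
Proof.
move=> /closure_normP cla /closure_normP clb s0 s1; apply/closure_normP => e e0.
have e2 : 0 < e / 2 by rewrite divr_gt0.
have [a1 Da aa1] := cla _ e2; have [b1 Db bb1] := clb _ e2.
have /closure_normP/(_ _ e2)[w Dw ww] := segment_closure_domain _ _ _ Da Db s0 s1.
exists w => //.
have := ler_normD (a + s *: (b - a) - (a1 + s *: (b1 - a1))) (a1 + s *: (b1 - a1) - w).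
rewrite addrA subrK => /le_lt_trans; apply.
have -> : a + s *: (b - a) - (a1 + s *: (b1 - a1)) =
          (1 - s) *: (a - a1) + s *: (b - b1).
  rewrite scalerBl scale1r opprD addrACA -scalerBr -[in RHS]addrA.
  rewrite [- (s *: _) + _]addrC -scalerBr !opprB.
  by rewrite [a1 - b1]addrC addrACA [- a + a1]addrC.
have := ler_normD ((1 - s) *: (a - a1)) (s *: (b - b1)).
rewrite !normrZ (ger0_norm s0) ger0_norm ?subr_ge0//.
have : 0 <= (1 - s) * (e / 2 - `|a - a1|) by rewrite mulr_ge0 ?subr_ge0// ltW.
have : 0 <= s * (e / 2 - `|b - b1|) by rewrite mulr_ge0 ?subr_ge0// ltW.
by lra.
Qed.

Lemma maximal_monotone_midpoint y (f g : dual X) :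
  A y f -> A y g -> A y (2^-1 *: (f + g)).
Proof.
move=> Af Ag; apply: maximal_monotone_related => a a' Aa; have [monoA _] := maxA.
have := monoA _ _ _ _ Af Aa; have := monoA _ _ _ _ Ag Aa.
by rewrite /pairing !dualB !dualE; lra.
Qed.

Lemma maximal_monotone_closed y : closed (A y).
Proof.
move=> f /closure_normP clf; apply: maximal_monotone_related => a a' Aa.
have [monoA _] := maxA; apply/ler_addgt0Pr => e e0.
have ya : 0 < `|a - y| + 1 by rewrite ltr_wpDl.
have [g Ag fg] := clf _ (divr_gt0 e0 ya); have := monoA _ _ _ _ Aa Ag.
have := dual_le (f - g) (a - y).
have : `|f - g| * `|a - y| <= e.
  apply: le_trans (ler_wpM2r (normr_ge0 _) (ltW fg)) _.
  by rewrite mulrAC ler_pdivrMr// ler_pM2l// lerDl.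
by rewrite /pairing !sub_dualE; lra.
Qed.

(** The values of [A] are closed and midpoint convex, so on the domain a minimal-norm element exists
    and [xget] does not fall back on its default. *)
Lemma min_norm_selection_in y : op_domain A y -> A y (min_norm_selection A y).
Proof.
move=> Dy; suff [] : min_norm_elements (A y) (min_norm_selection A y) by [].
apply: xgetPex; have [f Af fmin] := min_norm_exists (A y) uX'
  (dual_cauchy_complete X) Dy (maximal_monotone_midpoint y)
  (maximal_monotone_closed y).
by exists f.
Qed.

(** * Normal cones *)

(** For [w] in the domain and the ball, monotonicity gives [y' (w - y) <= rho * |w - y|]. Taking [w]
    close to [y + s *: (z - y)] transfers this to [s *: (z - y)], and [s] cancels. *)
Lemma bounded_selection_le (x y z : X) (y' : dual X) (r rho : R) :
  (forall y : X, (ball x r `&` op_domain A) y ->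
     `|min_norm_selection A y| <= rho) ->
  ball x r y -> A y y' -> closure (op_domain A) z ->
  y' (z - y) <= rho * `|z - y|.
Proof.
move=> bounded; rewrite -ball_normE /= => xy Ay Dz; have [monoA _] := maxA.
have Dy : closure (op_domain A) y by apply: subset_closure; exists y'.
have rho0 : 0 <= rho.
  apply: le_trans (bounded y _) => //; split; last by exists y'.
  by rewrite -ball_normE.
pose d := r - `|x - y|; have d0 : 0 < d by rewrite subr_gt0.
(* This [s] keeps [s * |z - y|] below [d / 2]. *)
pose s := Num.min 1 (d / (2 * (`|z - y| + 1))).
have zy1 : 0 < 2 * (`|z - y| + 1) by rewrite mulr_gt0// ltr_wpDl.
have s0 : 0 < s by rewrite lt_min ltr01 divr_gt0.
have s1 : s <= 1 by rewrite ge_min lexx.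
have sd : s * (2 * (`|z - y| + 1)) <= d.
  by rewrite -ler_pdivlMr// ge_min lexx orbT.
have /closure_normP clu := closure_domain_convex _ _ _ Dy Dz (ltW s0) s1.
rewrite -(ler_pM2l s0) -dualZ; apply/ler_addgt0Pr => e e0.
have ry : 0 < rho + `|y'| + 1 by rewrite ltr_wpDl ?addr_ge0.
(* The tolerance [d / 2] keeps [w] in the ball; the other one makes the error
   [(rho + |y'|) * |y + q - w|] smaller than [e]. *)
have [|w Dw] := clu (Num.min (d / 2) (e / (rho + `|y'| + 1))).
  by rewrite lt_min !divr_gt0.
rewrite lt_min => /andP[wd]; rewrite ltr_pdivlMr// => we.
set q := s *: (z - y) in wd we *.
have qE : `|q| = s * `|z - y| by rewrite normrZ gtr0_norm.
have wq : `|w - y| <= `|q| + `|y + q - w|.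
  have := ler_normB q (y + q - w).
  by rewrite opprB addrCA opprD (addrCA q) subrr addr0.
have xw : ball x r w.
  rewrite -ball_normE /=; have := ler_normD (x - y) (y - w); rewrite addrA subrK.
  by rewrite (distrC y w) /d in wd sd d0 *; lra.
have := monoA _ _ _ _ (min_norm_selection_in _ Dw) Ay.
have := bounded w (conj xw Dw); move: (min_norm_selection A w) => w' w'rho.
have := dual_le w' (w - y); have := dual_le y' (y + q - w).
rewrite /pairing sub_dualE.
have -> : y' (y + q - w) = y' q - y' (w - y) :> R by rewrite !dualE; lra.
have h1 : `|w'| * `|w - y| <= rho * (`|q| + `|y + q - w|).
  by apply: ler_pM.
by rewrite qE in h1 *; have := normr_ge0 (y + q - w); lra.
Qed.

Lemma normal_cone_decomposition (y : X) (y' : dual X) (rho : R) : 0 < rho ->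
  op_domain A y ->
  (forall z, closure (op_domain A) z -> y' (z - y) <= rho * `|z - y|) ->
  [set n + b | n in normal_cone y (closure (op_domain A))
             & b in [set rho *: u | u in dual_closed_unit_ball X]] y'.
Proof.
move=> rho0 Dy yle.
(* The second coordinate is [y'] evaluated at the first, so a sandwiched [f] dominates [y'] on the
   cone. Closure of [K] under sums rests on the convexity of the closed domain. *)
pose K : set (X * R) := [set k | exists l z,
  [/\ 0 <= l, closure (op_domain A) z & k = (l *: (z - y), l * y' (z - y))]].
have cly : closure (op_domain A) y by exact: subset_closure.
have [||k|f frho fK] := @cone_sandwich _ X rho K.
- exact: ltW.
- split.
  + by exists 0, y; rewrite scale0r mul0r.
  + move=> _ _ [l [z [l0 Dz ->]]] [m [w [m0 Dw ->]]] /=.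
    have [lm0|lm0] := eqVneq (l + m) 0.
      have -> : l = 0 by lra.
      have -> : m = 0 by lra.
      by exists 0, y; rewrite !scale0r !mul0r !addr0.
    have lmp : 0 < l + m by rewrite lt_neqAle eq_sym lm0 addr_ge0.
    have E : l *: (z - y) + m *: (w - y) =
        (l + m) *: (z + (m / (l + m)) *: (w - z) - y).
      rewrite [in RHS]addrAC [in RHS]scalerDr scalerA mulrCA mulfV// mulr1.
      by rewrite scalerDl -[in RHS]addrA -scalerDr [z - y + _]addrC addrA subrK.
    exists (l + m), (z + (m / (l + m)) *: (w - z)); split; first exact: ltW.
      apply: closure_domain_convex => //; first by rewrite divr_ge0// ltW.
      by rewrite ler_pdivrMr// mul1r lerDr.
    by rewrite -!dualZ -E dualD.
  + move=> a _ a0 [l [z [l0 Dz ->]]] /=; exists (a * l), z.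
    by rewrite mulr_ge0// scalerA mulrA.
- move=> [l [z [l0 Dz ->]]] /=; rewrite normrZ ger0_norm// mulrCA.
  by rewrite ler_wpM2l// yle.
exists (y' - f); last first.
  exists f; last by rewrite subrK.
  exists (rho^-1 *: f); last by rewrite scalerA mulfV ?scale1r// gt_eqF.
  rewrite /dual_closed_unit_ball /= normrZ gtr0_norm ?invr_gt0//.
  by rewrite ler_pdivrMl// mulr1.
apply: ge_ereal_sup => _ [z Dz <-]; rewrite lee_fin /pairing sub_dualE subr_le0.
by apply: (fK (z - y, y' (z - y))); exists 1, z; rewrite scale1r mul1r.
Qed.

End maximal_monotone.

(** Small steps from [y] in every direction stay in the ball, so [n h <= 0] for all [h], and hence
    also for [- h]. *)
Lemma normal_cone_ball {R : realType} {X : normedModType R} (S : set X)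
    (x y : X) (r : R) (n : dual X) :
  ball x r `<=` S -> ball x r y -> normal_cone y S n -> n = 0.
Proof.
move=> xS; rewrite -ball_normE /= => xy nN.
have nle z : ball x r z -> n (z - y) <= 0.
  move=> xz; rewrite -lee_fin; apply: le_trans nN.
  by apply: ereal_sup_ubound; exists z => //; exact: xS.
have n_le0 h : n h <= 0.
  have h1 : 0 < `|h| + 1 by rewrite ltr_wpDl.
  have d0 : 0 < r - `|x - y| by rewrite subr_gt0.
  pose s := (r - `|x - y|) / (`|h| + 1).
  have s0 : 0 < s by rewrite divr_gt0.
  have : ball x r (y + s *: h).
    rewrite -ball_normE /= opprD addrA; apply: le_lt_trans (ler_normB _ _) _.
    rewrite normrZ gtr0_norm// -ltrBrDl /s mulrAC ltr_pdivrMr// ltr_pM2l//.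
    by rewrite ltrDl.
  by move=> /nle; rewrite addrAC subrr add0r dualZ pmulr_rle0.
apply/val_inj/funext => h; apply/eqP; rewrite eq_le.
by have := n_le0 (- h); rewrite dualN oppr_le0 n_le0.
Qed.

Theorem corollary3p3 (R : realType) (X : completeNormedModType R)
  (uX : uniformly_convex X) (uX' : uniformly_convex (dual X))
  (A : X -> set (dual X)) (maxA : maximal_monotone A)
  (x : X) (Dx : op_domain A x)
  (r rho : R) (r0 : 0 < r) (rho0 : 0 < rho)
  (bounded_sel : forall y : X, (ball x r `&` op_domain A) y ->
     `|min_norm_selection A y| <= rho) :
  (forall y : X, (ball x r `&` op_domain A) y ->
     A y `<=` [set n + b | n in normal_cone y (closure (op_domain A))
                         & b in [set rho *: u | u in dual_closed_unit_ball X]])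
  /\
  (ball x r `<=` op_domain A ->
     forall y : X, ball x r y ->
       A y `<=` [set rho *: u | u in dual_closed_unit_ball X]).
Proof.
have main (y : X) : (ball x r `&` op_domain A) y ->
     A y `<=` [set n + b | n in normal_cone y (closure (op_domain A))
                         & b in [set rho *: u | u in dual_closed_unit_ball X]].
  move=> [xy Dy] y' Ay; apply: normal_cone_decomposition => // z Dz.
  exact: bounded_selection_le bounded_sel xy Ay Dz.
split=> // xrD y xy y' /(main y (conj xy (xrD y xy)))[n nN [b bB <-]].
have -> : n = 0 by apply: normal_cone_ball xy nN => z /xrD; exact: subset_closure.
by rewrite add0r.
Qed.
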